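(* There are uncountably many mutation-equivalence classes of exchange quivers $Q_{\mathfrak{t}}$ of locally finite triangulations $\mathfrak{t}$ of the $\infty$-gon. Likewise, there are uncountably many mutation-equivalence classes of exchange quivers of triangulations of the $\infty$-gon with a fountain, and uncountably many mutation-equivalence classes of exchange quivers of triangulations of the $\infty$-gon with a split fountain.
   Context: The $\infty$-gon is the line of integers $\mathbb{Z}$. An arc is a pair of integers $(m,n)$ with $m\le n-2$; a side is a pair $(n,n+1)$. Arcs $(i,j)$ and $(m,n)$ intersect if $i<m<j<n$ or $m<i<n<j$. A triangulation is a maximal set of pairwise non-intersecting arcs. A triangulation $\mathfrak{t}$ is locally finite if for every integer $n$ only finitely many arcs of $\mathfrak{t}$ have $n$ as an endpoint. An integer $n$ is a right-fountain (resp. left-fountain) of $\mathfrak{t}$ if $\mathfrak{t}$ contains infinitely many arcs of the form $(n,p)$ (resp. $(m,n)$), and a fountain if it is both. $\mathfrak{t}$ has a split fountain if it has a left-fountain $l$ and a right-fountain $r$ with $l\neq r$. Exchange quiver $Q_{\mathfrak{t}}$: an ice quiver with one frozen vertex for each side $(i,i+1)$, $i\in\mathbb{Z}$, and one mutable vertex for each arc in $\mathfrak{t}$, vertices being labelled by the corresponding sides and arcs. For every triple $i<j<k$ such that each of $(i,j),(j,k),(i,k)$ is an arc of $\mathfrak{t}$ or a side, there are arrows $(i,j)\to(i,k)\to(j,k)\to(i,j)$; all arrows between two frozen vertices are then discarded. There are no other arrows. Mutation of $Q_{\mathfrak{t}}$ at an arc $(i,j)$ is Fomin–Zelevinsky quiver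 mutation; it corresponds to the diagonal flip of $\mathfrak{t}$ replacing $(i,j)$ by the unique other arc that gives again a triangulation, and the mutated vertex is relabelled by that new arc. (In a triangulation with left-fountain $l$ and right-fountain $r\ne l$, the arc $(l,r)$, if $r\geq l+2$, has no flip and is not mutated; it is regarded as frozen.) Two exchange quivers are mutation-equivalent if one is obtained from the other by a finite sequence of mutations. *)

(* Defs.v *)
From Stdlib Require Export Relation_Operators.
From mathcomp Require Export all_boot all_order all_algebra.
From mathcomp Require Export boolp classical_sets functions cardinality.

Set Implicit Arguments.
Unset Strict Implicit.
Unset Printing Implicit Defensive.

Import Order.TTheory GRing.Theory Num.Theory.

Local Open Scope classical_set_scope.
Local Open Scope ring_scope.

(* Labels of the vertices of exchange quivers; (m, n) is the arc or side from
   m to n. *)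
Definition label : Type := int * int.

Definition is_arc (a : label) : Prop := a.1 + 2 <= a.2.

Definition is_side (a : label) : Prop := a.2 = a.1 + 1.

Definition intersect (a b : label) : Prop :=
  (a.1 < b.1 /\ b.1 < a.2 /\ a.2 < b.2) \/
  (b.1 < a.1 /\ a.1 < b.2 /\ b.2 < a.2).

Definition nonintersecting_arcs (t : set label) : Prop :=
  t `<=` is_arc /\ (forall a b, t a -> t b -> ~ intersect a b).

Definition triangulation (t : set label) : Prop :=
  nonintersecting_arcs t /\
  (forall s, nonintersecting_arcs s -> t `<=` s -> s = t).

Definition locally_finite (t : set label) : Prop :=
  forall n : int, finite_set [set a | t a /\ (a.1 = n \/ a.2 = n)].

Definition right_fountain (t : set label) (n : int) : Prop :=
  infinite_set [set a | t a /\ a.1 = n].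

Definition left_fountain (t : set label) (n : int) : Prop :=
  infinite_set [set a | t a /\ a.2 = n].

Definition has_fountain (t : set label) : Prop :=
  exists n, left_fountain t n /\ right_fountain t n.

Definition has_split_fountain (t : set label) : Prop :=
  exists l r, [/\ left_fountain t l, right_fountain t r & l <> r].

(* Ice quivers with vertices labelled by pairs of integers: [arrows q u v] is
   the number of arrows from u to v.  Equality of such quivers is equality of
   labelled quivers up to the names of the arrows. *)
Record ice_quiver := IceQuiver {
  vertices : set label;
  frozen : set label;
  arrows : label -> label -> nat }.

Definition arc_or_side (t : set label) (e : label) : Prop := t e \/ is_side e.

(* u -> v is one of the arrows (i,j) -> (i,k) -> (j,k) -> (i,j) of a triangle
   i < j < k.  The labels u and v determine the triangle, so the multiplicity
   of such an arrow is 1. *)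
Definition triangle_arrow (t : set label) (u v : label) : Prop :=
  exists i j k : int,
    [/\ i < j, j < k,
        [/\ arc_or_side t (i, j), arc_or_side t (j, k)
          & arc_or_side t (i, k)]
      & [\/ u = (i, j) /\ v = (i, k),
            u = (i, k) /\ v = (j, k)
          | u = (j, k) /\ v = (i, j)]].

(* The second alternative is the arc (l, r) between the left-fountain l and the
   right-fountain r <> l of a triangulation with a split fountain; an arc has
   distinct endpoints, so this does not concern fountains. *)
Definition frozen_label (t : set label) (a : label) : Prop :=
  is_side a \/ [/\ t a, left_fountain t a.1 & right_fountain t a.2].

Definition exchange_quiver (t : set label) : ice_quiver := {|
  vertices := arc_or_side t;
  frozen := frozen_label t;
  arrows u v := nat_of_bool
    `[< triangle_arrow t u v /\ ~ (frozen_label t u /\ frozen_label t v) >] |}.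

(* Fomin-Zelevinsky mutation at k: add an arrow i -> j for each path
   i -> k -> j, reverse the arrows at k, remove a maximal set of 2-cycles (this
   is the truncated subtraction) and the arrows between frozen vertices. *)
Definition mutate (k : label) (q : ice_quiver) : ice_quiver := {|
  vertices := vertices q;
  frozen := frozen q;
  arrows i j :=
    (if (i == k) || (j == k) then arrows q j i
     else if `[< frozen q i /\ frozen q j >] then 0
     else (arrows q i j + arrows q i k * arrows q k j)
          - (arrows q j i + arrows q j k * arrows q k i))%N |}.

Definition swap_label (a b x : label) : label :=
  if x == a then b else if x == b then a else x.

(* When b is not a vertex of q, this relabels the vertex a of q by b. *)
Definition relabel (a b : label) (q : ice_quiver) : ice_quiver := {|
  vertices := vertices q \o swap_label a b;
  frozen := frozen q \o swap_label a b;
  arrows u v := arrows q (swap_label a b u) (swap_label a b v) |}.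

(* If t is a triangulation, b is not in t, by maximality of t. *)
Definition flip (t : set label) (a b : label) : Prop :=
  [/\ t a, b <> a & triangulation ((t `\ a) `|` [set b])].

(* The vertices of [exchange_quiver t] that are arcs form t. *)
Definition quiver_mutation (q q' : ice_quiver) : Prop :=
  exists a b : label,
    [/\ ~ frozen q a, flip (vertices q `&` is_arc) a b
      & q' = relabel a b (mutate a q)].

Definition mutation_equivalent : ice_quiver -> ice_quiver -> Prop :=
  clos_refl_trans ice_quiver quiver_mutation.

Definition is_exchange_quiver (q : ice_quiver) : Prop :=
  exists2 t, triangulation t & q = exchange_quiver t.

Definition mutation_class (q : ice_quiver) : set ice_quiver :=
  [set q' | is_exchange_quiver q' /\ mutation_equivalent q q'].

Definition mutation_classes (P : set label -> Prop) : set (set ice_quiver) :=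
  [set C | exists t, [/\ triangulation t, P t
                       & C = mutation_class (exchange_quiver t)]].

(* Main.v *)
Require Import Defs.
From mathcomp Require Import classical_sets cardinality.
From mathcomp Require Import zify.

Local Open Scope classical_set_scope.
Local Open Scope ring_scope.

(** The labels of a quiver are part of its data, and a mutation changes the
    vertex set only at the two labels that it exchanges.  So the exchange
    quivers in one mutation-equivalence class come from triangulations that
    differ from each other by finitely many arcs; as there are countably many
    finite sets of arcs, a class comes from at most countably many
    triangulations ([countable_same_class]).  It remains to find uncountably
    many triangulations of each of the three kinds.

    For this, take a set [B] of arcs that forces the kind in question, and arcs
    [alpha n] and [beta n] such that [alpha n] crosses [beta n] and there are
    no other crossings among all these arcs: [alpha n] and [beta n] are the
    diagonals of the [n]-th of infinitely many quadrilaterals cut out by [B].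
    For every set [A] of natural numbers, choose [alpha n] if [n] is in [A] and
    [beta n] otherwise, and complete to a triangulation with Zorn's lemma
    ([triangulation_extension]).  This triangulation contains [alpha n] exactly
    when [n] is in [A], so distinct sets [A] give distinct triangulations, and
    Cantor's theorem applies ([uncountable_mutation_classes]).

    Locally finite triangulations are forced by the arcs around a growing
    sequence of nested intervals, and fountains and split fountains by a left
    fan at 0 and a right fan at [c], with [c = 0] and [c = 1]. *)

(** * Mutation classes and finite changes of triangulations *)

Lemma mutation_equivalent_vertices (q q' : ice_quiver) :
  mutation_equivalent q q' ->
  exists s : seq label, forall x, x \notin s -> vertices q x <-> vertices q' x.
Proof.
elim=> {q q'} [q q' [a [b [_ _ ->]]] | q | p q r _ [s1 E1] _ [s2 E2]].
- exists [:: a; b] => x; rewrite !inE negb_or /= /swap_label.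
  by case: (x == a); case: (x == b).
- by exists [::].
- exists (s1 ++ s2) => x; rewrite mem_cat negb_or => /andP[/E1 E1x /E2 E2x].
  by rewrite E1x.
Qed.

Lemma vertices_arcs {t : set label} : triangulation t ->
  forall x, t x <-> vertices (exchange_quiver t) x /\ is_arc x.
Proof.
move=> [[tarc _] _] x; split=> [tx|[[]//]].
  by split; [left | exact: tarc].
by rewrite /is_side /is_arc; lia.
Qed.

(** Relative to a fixed triangulation [t0] of the class, any other one is
    determined by a finite list of labels where it may differ from [t0] and by
    the sublist of its arcs; pairs of lists of labels are countably many. *)
Lemma countable_same_class (C : set ice_quiver) :
  countable [set t | triangulation t /\ mutation_class (exchange_quiver t) = C].
Proof.
have [[t0 [t0T t0C]]|nC] := pselect (exists t,
  triangulation t /\ mutation_class (exchange_quiver t) = C); last first.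
  apply: sub_countable (countable0 (set label)); apply: subset_card_le => t tC.
  by apply: nC; exists t.
pose modify (p : seq label * seq label) : set label :=
  (t0 `\` [set` p.1]) `|` [set` p.2].
suff sub : [set t | triangulation t /\ mutation_class (exchange_quiver t) = C]
    `<=` modify @` setT.
  apply: sub_countable (subset_card_le sub) _.
  exact: sub_countable (card_image_le _ _) (countableP _).
move=> t [tT tC].
have : mutation_class (exchange_quiver t) (exchange_quiver t).
  by split; [exists t | exact: rt_refl].
rewrite tC -t0C => -[_ /mutation_equivalent_vertices[s E]].
exists (s, [seq x <- s | `[< t x >]]) => //.
apply/seteqP; split=> x; rewrite /modify /= mem_filter.
  case=> [[t0x /negP xs]|/andP[/asboolP]//].
  apply/(vertices_arcs tT); move/(vertices_arcs t0T): t0x => [v a].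
  by split=> //; apply/(E _ xs).
move=> tx; have [xs|xs] := boolP (x \in s).
  by right; rewrite andbT; apply/asboolP.
left; split; last exact/negP.
apply/(vertices_arcs t0T); move/(vertices_arcs tT): tx => [v a].
by split=> //; apply/(E _ xs).
Qed.

(** * Uncountable families of triangulations *)

(** The union of a chain of sets of non-intersecting arcs is such a set, because
    two crossing arcs would already lie in one member of the chain. *)
Lemma triangulation_extension (B : set label) : nonintersecting_arcs B ->
  exists2 t, triangulation t & B `<=` t.
Proof.
move=> nB.
(* Stating the property for [B `|` X] makes it hold for the empty chain. *)
have [|X [nX maxX]] := @Zorn_bigcup _ [set X | nonintersecting_arcs (B `|` X)].
  move=> F FP Ftot; split=> [a|a b].
    by case=> [/nB.1//|[X /FP[arcX _] Xa]]; apply: arcX; right.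
  have [Barc Bcross] := nB.
  case=> [Ba|[X FX Xa]] [Bb|[Y FY Yb]].
  - exact: Bcross.
  - by apply: (FP _ FY).2; [left | right].
  - by apply: (FP _ FX).2; [right | left].
  - have [XY|YX] := Ftot _ _ FX FY.
      by apply: (FP _ FY).2; right => //; exact: XY.
    by apply: (FP _ FX).2; right => //; exact: YX.
exists (B `|` X); last by move=> x; left.
split=> // s ns BXs.
have Xs : X `<=` s by move=> x Xx; apply: BXs; right.
apply/seteqP; split=> // x sx; apply: contrapT => nx.
apply: (maxX s).
  split=> // sX; apply: nx; right; exact: sX.
rewrite /= setUidr // => y By; apply: BXs; by left.
Qed.

Lemma uncountable_sets (T : Type) (f : set nat -> T) :
  injective f -> ~ countable (range f).
Proof.
move=> f_inj /countable_injP[g g_inj].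
pose D := [set n | exists2 A, g (f A) = n & ~ A n].
have [DgfD|nDgfD] := pselect (D (g (f D))); last by apply: (nDgfD); exists D.
case: (DgfD) => A gfAD; apply.
suff /f_inj -> : f A = f D by [].
by apply: g_inj => //; apply/mem_set; eexists.
Qed.

(** Choosing one of the crossing arcs [alpha n] and [beta n] encodes whether
    [n] is in [A]. *)
Definition diagonals (B : set label) (alpha beta : nat -> label) (A : set nat) :
    set label :=
  B `|` (alpha @` A `|` beta @` ~` A).

(** A triangulation cannot contain both [alpha n] and [beta n], so a completion
    of [diagonals B alpha beta A] to a triangulation determines [A].  Countably
    many classes would leave only countably many such completions. *)
Lemma uncountable_mutation_classes (P : set label -> Prop) (B : set label)
    (alpha beta : nat -> label) :
  (forall t, triangulation t -> B `<=` t -> P t) ->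
  (forall n, intersect (alpha n) (beta n)) ->
  (forall A, nonintersecting_arcs (diagonals B alpha beta A)) ->
  ~ countable (mutation_classes P).
Proof.
move=> PB cross ndiag countP.
have /choice[t tP] (A : set nat) :
    exists t, triangulation t /\ diagonals B alpha beta A `<=` t.
  by have [t] := triangulation_extension _ (ndiag A); exists t.
have PtA A : P (t A).
  by have [tT sub] := tP A; apply: PB => // x Bx; apply: sub; left.
have sub_t A A' : t A = t A' -> A `<=` A'.
  move=> tAA' n An; apply: contrapT => nA'.
  have [[[_ ncross] _] sub] := tP A'.
  apply: (ncross (alpha n) (beta n)) => //; last first.
    by apply: sub; right; right; exists n.
  by rewrite -tAA'; apply: (tP A).2; right; left; exists n.
have t_inj : injective t.
  by move=> A A' E; apply/seteqP; split; apply: sub_t.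
apply: (uncountable_sets _ _ t_inj).
apply: sub_countable
  (bigcup_countable countP (fun C _ => countable_same_class C)).
apply: subset_card_le => _ [A _ <-].
exists (mutation_class (exchange_quiver (t A))) => /=.
  by exists (t A); split=> //; exact: (tP A).1.
by split=> //; exact: (tP A).1.
Qed.

(** * Locally finite triangulations *)

(** When [`|n| < N], the arc [(- N, N)] of [t] keeps all arcs of [t] at [n]
    inside its interval, where only finitely many arcs fit. *)
Lemma locally_finite_of_nested (t : set label) :
  (forall n : nat, t (- n.+1%:Z, n.+1%:Z)) ->
  (forall a b, t a -> t b -> ~ intersect a b) ->
  t `<=` is_arc -> locally_finite t.
Proof.
move=> nested ncross tarc n; pose N := `|n|%N.+1.
have fin : finite_set [set ((x%:Z - N%:Z, y%:Z - N%:Z) : label) |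
    x in `I_(N + N).+1 & y in `I_(N + N).+1].
  by apply: finite_image2; exact: finite_II.
apply: sub_finite_set fin => -[x y] /= [txy xyn].
have := ncross _ _ (nested `|n|%N) txy; have := tarc _ txy.
rewrite /intersect /is_arc /= -/N => xy nc.
have [xN yN] : - N%:Z <= x <= N%:Z /\ - N%:Z <= y <= N%:Z.
  by split; move: nc; rewrite /N; lia.
exists (absz (x + N%:Z)); first by rewrite /=; lia.
exists (absz (y + N%:Z)); first by rewrite /=; lia.
by congr pair => /=; lia.
Qed.

Lemma uncountable_locally_finite :
  ~ countable (mutation_classes locally_finite).
Proof.
pose B : set label := range (fun n : nat => (- n.+1%:Z, n.+1%:Z)).
(* Consecutive arcs of [B] bound the quadrilateral with vertices
   [- n.+2, - n.+1, n.+1, n.+2]. *)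
pose alpha (n : nat) : label := (- n.+2%:Z, n.+1%:Z).
pose beta (n : nat) : label := (- n.+1%:Z, n.+2%:Z).
apply: (uncountable_mutation_classes _ B alpha beta) =>
  [t [[tarc tcross] _] Bt|n|A].
- by apply: locally_finite_of_nested => // n; apply: Bt; exists n.
- by rewrite /intersect /=; lia.
split=> [a|a b]; rewrite /diagonals.
  by case=> [[n _ <-]|[[n _ <-]|[n _ <-]]]; rewrite /is_arc /=; lia.
case=> [[n _ <-]|[[n An <-]|[n An <-]]];
  case=> [[m _ <-]|[[m Am <-]|[m Am <-]]]; rewrite /intersect /=; try lia.
(* Only an [alpha] and a [beta] with the same index could cross, and just one
   of these two was chosen. *)
- have nm : n <> m by move=> nm; apply: Am; rewrite -nm.
  lia.
- have nm : n <> m by move=> nm; apply: An; rewrite nm.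
  lia.
Qed.

(** * Triangulations with a fountain or a split fountain *)

Lemma infinite_of_injective_seq (T : Type) (S : set T) (f : nat -> T) :
  injective f -> (forall n, S (f n)) -> infinite_set S.
Proof.
move=> f_inj Sf finS; apply: infinite_nat.
suff <- : f @^-1` S = setT.
  by apply: finite_preimage => // n m _ _; exact: f_inj.
by apply/seteqP; split=> // n _; exact: Sf.
Qed.

Definition fans (c : nat) : set label :=
  range (fun n : nat => (- n.+2%:Z, 0)) `|`
  range (fun n : nat => (c%:Z, c%:Z + n.*2.+2%:Z)).

Lemma left_fountain_fans (c : nat) (t : set label) :
  fans c `<=` t -> left_fountain t 0.
Proof.
move=> ft; apply: (@infinite_of_injective_seq _ _
  (fun n : nat => (- n.+2%:Z, 0))).
  by move=> n m []; lia.
by move=> n; split=> //; apply: ft; left; exists n.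
Qed.

Lemma right_fountain_fans (c : nat) (t : set label) :
  fans c `<=` t -> right_fountain t c%:Z.
Proof.
move=> ft; apply: (@infinite_of_injective_seq _ _
  (fun n : nat => (c%:Z, c%:Z + n.*2.+2%:Z))).
  by move=> n m []; lia.
by move=> n; split=> //; apply: ft; right; exists n.
Qed.

(** The right fan leaves out every other arc, so that it cuts out the
    quadrilaterals [c, c + n.*2.+2, c + n.*2.+3, c + n.*2.+4]. *)
Lemma uncountable_fans (c : nat) (P : set label -> Prop) :
  (forall t, fans c `<=` t -> P t) -> ~ countable (mutation_classes P).
Proof.
move=> fansP.
pose alpha (n : nat) : label := (c%:Z, c%:Z + n.*2.+3%:Z).
pose beta (n : nat) : label := (c%:Z + n.*2.+2%:Z, c%:Z + n.*2.+4%:Z).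
apply: (uncountable_mutation_classes _ (fans c) alpha beta) => [t _|n|A].
- exact: fansP.
- by rewrite /intersect /=; lia.
split=> [a|a b]; rewrite /diagonals.
  by case=> [[[n _ <-]|[n _ <-]]|[[n _ <-]|[n _ <-]]]; rewrite /is_arc /=; lia.
case=> [[[n _ <-]|[n _ <-]]|[[n An <-]|[n An <-]]];
  case=> [[[m _ <-]|[m _ <-]]|[[m Am <-]|[m Am <-]]];
  rewrite /intersect /=; try lia.
(* Only an [alpha] and a [beta] with the same index could cross, and just one
   of these two was chosen. *)
- have nm : n <> m by move=> nm; apply: Am; rewrite -nm.
  lia.
- have nm : n <> m by move=> nm; apply: An; rewrite nm.
  lia.
Qed.

Theorem theorem3p14 :
  ~ countable (mutation_classes locally_finite) /\
  ~ countable (mutation_classes has_fountain) /\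
  ~ countable (mutation_classes has_split_fountain).
Proof.
split; first exact: uncountable_locally_finite.
split.
- apply: (uncountable_fans 0) => t ft; exists 0.
  by split; [exact: left_fountain_fans ft | exact: right_fountain_fans ft].
- apply: (uncountable_fans 1) => t ft; exists 0, 1%:Z.
  by split; [exact: left_fountain_fans ft | exact: right_fountain_fans ft |].
Qed.
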